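(* Let $p \geq 7$ be an integer. Then: (a) $\mathfrak{g}_{\mathrm{DSO}}(p) \geq 1$. (b) $\mathfrak{g}_{\mathrm{DSO}}(p) \leq p-3$ if $p \not\equiv 2 \pmod 4$. (c) $\mathfrak{g}_{\mathrm{ODJM}}(p) \geq 1$ if $p$ is even, and $\mathfrak{g}_{\mathrm{ODJM}}(p) \geq 2$ if $p$ is odd. (d) $\mathfrak{g}_{\mathrm{ODJM}}(p) \leq p-3$.
   Context: Write $\mathbb{R}_+ = (0,\infty)$. For $a \in \mathbb{R}_+^p$ and $v \in \mathbb{R}^p$, let $J_{a,v}(\theta)$, $\theta \in \mathbb{R}$, be the Hermitian $p\times p$ matrix with diagonal entries $v_1,\dots,v_p$, entries $a_1,\dots,a_{p-1}$ on the first super- and sub-diagonals (i.e. the $(j,j+1)$ and $(j+1,j)$ entries equal $a_j$ for $1\le j\le p-1$), $(1,p)$ entry $e^{-2\pi i \theta}a_p$, $(p,1)$ entry $e^{2\pi i\theta}a_p$, and all other entries zero. (These are the Floquet matrices of the periodic Jacobi matrix $[\mathbf{J}_{a,v}\psi](n) = A(n-1)\psi(n-1)+V(n)\psi(n)+A(n)\psi(n+1)$ on $\ell^2(\mathbb{Z})$, where $A,V$ are the $p$-periodic extensions of $a,v$.) Let $\lambda_1(\theta)\le\cdots\le\lambda_p(\theta)$ be the eigenvalues of $J_{a,v}(\theta)$ counted with multiplicity, and put $\lambda_j^- = \min_{\theta\in[0,1]}\lambda_j(\theta)$, $\lambda_j^+ = \max_{\theta\in[0,1]}\lambda_j(\theta)$.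 It is known that $\lambda_1^-<\lambda_1^+\le\lambda_2^-<\cdots\le\lambda_p^-<\lambda_p^+$. A number $\lambda\in\mathbb{R}$ is a closed gap of $(a,v)$ if $\lambda=\lambda_j^+=\lambda_{j+1}^-$ for some $1\le j\le p-1$. Let $\mathfrak{g}(a,v)$ be the number of closed gaps of $(a,v)$; put $\mathfrak{g}_{\mathrm{DSO}}(v)=\mathfrak{g}(\mathbf{1},v)$ for $v\in\mathbb{R}^p$, where $\mathbf{1}=(1,\dots,1)$, and $\mathfrak{g}_{\mathrm{ODJM}}(a)=\mathfrak{g}(a,\mathbf{0})$ for $a\in\mathbb{R}_+^p$, where $\mathbf{0}=(0,\dots,0)$. Let $\mathrm{cyc}(v_1,\dots,v_p)=(v_2,\dots,v_p,v_1)$. A vector $v \in \mathbb{R}^p$ is irreducible if $v,\mathrm{cyc}(v),\dots,\mathrm{cyc}^{p-1}(v)$ are pairwise distinct, and reducible otherwise. Define $\mathfrak{g}_{\mathrm{DSO}}(p)=\max\{\mathfrak{g}_{\mathrm{DSO}}(v): v\in\mathbb{R}^p \text{ irreducible}\}$ and $\mathfrak{g}_{\mathrm{ODJM}}(p)=\max\{\mathfrak{g}_{\mathrm{ODJM}}(a): a\in\mathbb{R}_+^p\text{ irreducible}\}$. *)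

(* Defs.v *)
From HB Require Import structures.
From mathcomp Require Import all_boot all_order all_algebra finmap.
From mathcomp Require Import all_classical all_reals all_analysis.
From mathcomp Require Import complex.
Import Order.TTheory GRing.Theory Num.Theory.

Set Implicit Arguments.
Unset Strict Implicit.
Unset Printing Implicit Defensive.

Local Open Scope classical_set_scope.
Local Open Scope ring_scope.
Local Open Scope complex_scope.

Definition is_max {d} {T : porderType d} (S : set T) (m : T) : Prop :=
  S m /\ ubound S m.

Definition is_min {d} {T : porderType d} (S : set T) (m : T) : Prop :=
  S m /\ lbound S m.

(* The default value 0 is returned only when S has no maximum, i.e. when S is
   empty or unbounded. *)
Definition max_nat (S : set nat) : nat := xget 0%N [set m | is_max S m].

Section Jacobi.
Variables (R : realType) (p : nat).
Implicit Types (a v : 'rV[R]_p) (theta : R).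

Definition expi2pi theta : R[i] :=
  cos (2 * pi * theta) +i* sin (2 * pi * theta).

(* Indices run over 0, ..., p - 1, so that the corner weight a_p is the last
   entry of a.  The clauses are mutually exclusive as soon as p >= 3. *)
Definition floquet_mx a v theta : 'M[R[i]]_p :=
  \matrix_(i, j)
    if i == j then (v 0 i)%:C
    else if j == i.+1 :> nat then (a 0 i)%:C
    else if i == j.+1 :> nat then (a 0 j)%:C
    else if (i == 0%N :> nat) && (j == p.-1 :> nat) then
      expi2pi (- theta) * (a 0 j)%:C
    else if (i == p.-1 :> nat) && (j == 0%N :> nat) then
      expi2pi theta * (a 0 i)%:C
    else 0.

(* Nondecreasing list of the roots, with multiplicity, of the characteristic
   polynomial; the real parts are the roots themselves when M is Hermitian. *)
Definition eigenvalues (M : 'M[R[i]]_p) : seq R :=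
  sort <=%R [seq complex.Re z | z <- sval (closed_field_poly_normal (char_poly M))].

(* lambda_ a v j is the (j + 1)-st eigenvalue function. *)
Definition lambda_ a v (j : nat) theta : R :=
  (eigenvalues (floquet_mx a v theta))`_j.

Definition band a v (j : nat) : set R := lambda_ a v j @` `[0, 1].

Definition closed_gap a v : set R :=
  [set x | exists j : nat,
     [/\ (j.+1 < p)%N, is_max (band a v j) x & is_min (band a v j.+1) x]].

(* fset_set is junk only on infinite sets; closed_gap a v has at most p - 1
   elements, since a maximum is unique and so each j contributes at most one. *)
Definition ngaps a v : nat := #|` fset_set (closed_gap a v)|.

Definition ngapsDSO v : nat := ngaps (const_mx 1) v.
Definition ngapsODJM a : nat := ngaps a 0.

Definition cyc v : 'rV[R]_p := \row_i v 0 (ordS i).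

Definition irreducible v : Prop :=
  forall k l : 'I_p, iter k cyc v = iter l cyc v -> k = l.

End Jacobi.

Definition gDSO (R : realType) (p : nat) : nat :=
  max_nat [set ngapsDSO v | v in [set v : 'rV[R]_p | irreducible v]].

Definition gODJM (R : realType) (p : nat) : nat :=
  max_nat [set ngapsODJM a | a in
    [set a : 'rV[R]_p | (forall i, 0 < a 0 i) /\ irreducible a]].

(* Main.v *)
Require Import Defs.
From mathcomp Require Import all_boot all_order all_algebra finmap.
From mathcomp Require Import all_classical all_reals all_analysis.
From mathcomp Require Import complex zify ring lra.
Import Order.TTheory GRing.Theory Num.Theory.

(** A closed gap is the same thing as a double eigenvalue of one Floquet matrix
J(theta), and this reduces everything to statements about kernels.

If x is both the maximum of one band and the minimum of the next, it is an
eigenvalue of some J(theta1) and some J(theta2).  The Wronskian of the two Bloch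
waves is constant, so their multipliers are equal or inverse to each other;
J(theta2) is then J(theta1) or its transpose, the two spectra coincide, and x is
a double eigenvalue ([closed_gap_double_eigenvalue]).  Conversely, two Floquet
matrices have the same quadratic form on the hyperplane of vectors vanishing at
site 0, so their spectra interlace up to one index; a double eigenvalue of one
J(theta) therefore separates two consecutive bands for every theta
([double_eigenvalue_closed_gap]).

For the upper bounds, let K k m be the characteristic polynomial of the Jacobi
matrix cut down to the sites k, ..., k + m - 1.  At a closed gap x the Bloch
waves with a common multiplier z form a plane, so for each k one of them
vanishes at site k.  Following it over one period gives K (k+1) (p-1) (x) = 0
for every k and, when all weights are 1, K (k+1) (p-2) (x) = - z, a value
independent of k.  Hence
  - for the Schroedinger operator, K (k+1) (p-2) - K (k+2) (p-2),
  - for the off-diagonal operator, K (k+1) (p-1) - K (k+2) (p-1),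
are polynomials of degree at most p - 3 vanishing at all closed gaps.  With
p - 2 closed gaps they are zero, and their coefficient of degree p - 3 says
V (k+1) = V (k-1), respectively A (k+1)^2 = A (k-1)^2: the data are invariant
under a shift by two sites, hence reducible ([ngapsDSO_le], [ngapsODJM_le]).

For the lower bounds, take the positive integers w = (p-2, 1, 2, ..., 2, 1)
counting the triangles at each vertex of a fan-triangulated p-gon.  As for every
Conway-Coxeter frieze, all solutions of f (j-1) + f (j+1) = w j * f j are
antiperiodic.  So v = - w has a closed gap at 0.  Putting g j = sqrt (w j) * f j
turns the same equation into the off-diagonal one with weights
a j = 1 / sqrt (w j * w (j+1)) and energy 1.  For odd p the substitution
g j -> (-1)^j * g j turns antiperiodic waves of energy 1 into periodic waves of
energy -1, a second closed gap. *)

Set Implicit Arguments.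
Unset Strict Implicit.
Unset Printing Implicit Defensive.

Local Open Scope classical_set_scope.
Local Open Scope ring_scope.
Local Open Scope complex_scope.
Local Open Scope sesquilinear_scope.

(** * Entries of sorted lists *)

Lemma nth_le_of_count (R : realType) (s : seq R) (x : R) k :
  sorted <=%R s -> (k < count (fun y => (y <= x)%R) s)%N -> s`_k <= x.
Proof.
move=> ss; apply: contraTT; rewrite -ltNge -leqNgt => xk.
rewrite -[X in count _ X](cat_take_drop k) count_cat.
suff -> : count (fun y => (y <= x)%R) (drop k s) = 0%N.
  by rewrite addn0 (leq_trans (count_size _ _))// size_take geq_minl.
apply/eqP; rewrite -leqn0 leqNgt -has_count; apply/hasPn => y.
move=> /(nthP 0)[j]; rewrite size_drop ltn_subRL => ki <-; rewrite nth_drop.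
rewrite -ltNge (lt_le_trans xk)// (sorted_leq_nth le_trans le_refl)//.
- by rewrite inE (leq_ltn_trans _ ki) ?leq_addr.
- by rewrite leq_addr.
Qed.

Lemma nth_ge_of_count (R : realType) (s : seq R) (x : R) k :
  sorted <=%R s -> (k < size s)%N ->
  (size s <= k + count (fun y => (x <= y)%R) s)%N -> x <= s`_k.
Proof.
move=> ss ks; apply: contraTT; rewrite -ltNge -ltnNge => xk.
rewrite -[X in count _ X](cat_take_drop k.+1) count_cat.
suff -> : count (fun y => (x <= y)%R) (take k.+1 s) = 0%N.
  rewrite add0n; have := count_size (fun y => (x <= y)%R) (drop k.+1 s).
  by rewrite size_drop => h; rewrite -ltn_subRL (leq_ltn_trans h)// ltn_sub2l.
apply/eqP; rewrite -leqn0 leqNgt -has_count; apply/hasPn => y.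
move=> /(nthP 0)[j]; rewrite size_take_min leq_min => /andP[jk _] <-.
rewrite nth_take// -ltNge (le_lt_trans _ xk)//.
rewrite (sorted_leq_nth le_trans le_refl)// inE.
exact: leq_ltn_trans ks.
Qed.

Lemma count_pair (R : realType) (s : seq R) (x : R) k :
  (k.+1 < size s)%N -> s`_k = x -> s`_k.+1 = x ->
  (2 <= count (pred1 x) s)%N.
Proof.
move=> ks xk xk1; rewrite -(cat_take_drop k s) count_cat.
rewrite (drop_nth 0) ?(ltnW ks)// (drop_nth 0)// /= xk xk1 eqxx; lia.
Qed.

(** * Hermitian matrices *)

Lemma nonzero_solution (F : fieldType) n m (B : 'M[F]_(n, m)) :
  (m < n)%N -> exists2 u : 'rV[F]_n, u != 0 & u *m B = 0.
Proof.
move=> mn; have: kermx B != 0.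
  rewrite -mxrank_eq0 mxrank_ker subn_eq0 -ltnNge.
  exact: leq_ltn_trans (rank_leq_col B) mn.
by move=> /rowV0Pn[u /sub_kermxP uB u0]; exists u.
Qed.

Section Spectral.
Variables (R : realType) (n : nat).
Notation C := R[i].
Implicit Types M : 'M[C]_n.

Definition spec M (i : 'I_n) : R := complex.Re (spectral_diag M 0 i).

Definition spec_coord M (u : 'rV[C]_n) : 'rV[C]_n := u *m (spectralmx M)^t*.

Lemma spec_real M i : M \is hermsymmx -> spectral_diag M 0 i = (spec M i)%:C.
Proof.
by move=> /hermitian_spectral_diag_real /mxOverP H; rewrite /spec RRe_real.
Qed.

Lemma spec_decomp M : M \is hermsymmx ->
  M = (spectralmx M)^t* *m diag_mx (spectral_diag M) *m spectralmx M.
Proof.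
move=> /hermitian_normalmx/orthomx_spectralP {1}->.
by rewrite invmx_unitary ?spectral_unitarymx.
Qed.

Lemma spec_coordK M u : spec_coord M u *m spectralmx M = u.
Proof. by rewrite /spec_coord mulmxKtV ?spectral_unitarymx. Qed.

Lemma spec_coord_mul M u : M \is hermsymmx ->
  spec_coord M (u *m M) = spec_coord M u *m diag_mx (spectral_diag M).
Proof.
move=> hM; rewrite {2}(spec_decomp hM) /spec_coord !mulmxA.
by rewrite mulmxtVK ?spectral_unitarymx.
Qed.

Lemma spec_coord0 M u : spec_coord M u = 0 -> u = 0.
Proof. by rewrite -{2}(spec_coordK M u) => ->; rewrite mul0mx. Qed.

Definition sqmod (z : C) : R := complex.Re z ^+ 2 + complex.Im z ^+ 2.

Lemma sqmodE z : (sqmod z)%:C = z * (Num.conj z).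
Proof. by rewrite /sqmod add_Re2_Im2 sqr_normc. Qed.

Lemma sqmod_ge0 z : 0 <= sqmod z.
Proof. by rewrite addr_ge0 ?sqr_ge0. Qed.

Lemma sqmod_eq0 z : sqmod z = 0 -> z = 0.
Proof.
case: z => a b /eqP; rewrite /sqmod/= paddr_eq0 ?sqr_ge0// !sqrf_eq0.
by move=> /andP[/eqP-> /eqP->].
Qed.

Lemma herm_formE M (u : 'rV[C]_n) : M \is hermsymmx ->
  (u *m M *m u^t*) 0 0 = (\sum_i spec M i * sqmod (spec_coord M u 0 i))%:C.
Proof.
move=> hM; rewrite {1}(spec_decomp hM) !mulmxA -/(spec_coord M u).
rewrite -mulmxA.
have -> : spectralmx M *m u ^t* = (spec_coord M u)^t*.
  by rewrite /spec_coord trmx_mul map_mxM trmxCK.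
rewrite mul_mx_diag mxE rmorph_sum; apply: eq_bigr => i _.
rewrite rmorphM/= -spec_real// sqmodE mxE [in X in _ * X]mxE [in X in _ * X]mxE.
by rewrite [spec_coord _ _ _ _ * _]mulrC mulrA.
Qed.

Lemma normE M (u : 'rV[C]_n) : 
  (u *m u^t*) 0 0 = (\sum_i sqmod (spec_coord M u 0 i))%:C.
Proof.
rewrite -{1}(spec_coordK M u) -mulmxA.
have -> : spectralmx M *m u ^t* = (spec_coord M u)^t*.
  by rewrite /spec_coord trmx_mul map_mxM trmxCK.
rewrite mxE rmorph_sum; apply: eq_bigr => i _ /=.
by rewrite sqmodE [in X in _ * X]mxE [in X in _ * X]mxE.
Qed.

Lemma char_poly_spec M : M \is hermsymmx ->
  char_poly M = \prod_(z <- [seq (spec M i)%:C | i : 'I_n]) ('X - z%:P).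
Proof.
move=> hM; set P := spectralmx M; set D := diag_mx (spectral_diag M).
have PP : P^t* *m P = 1%:M.
  by rewrite -[P^t*]mul1mx mulmxKtV ?spectral_unitarymx.
have -> : char_poly M = char_poly D.
  rewrite /char_poly /char_poly_mx.
  have -> : 'X%:M - map_mx polyC M =
      map_mx polyC (P^t*) *m ('X%:M - map_mx polyC D) *m map_mx polyC P.
    rewrite mulmxBr mulmxBl -!map_mxM /= -spec_decomp//; congr (_ - _).
    by rewrite mul_mx_scalar -scalemxAl -map_mxM PP map_mx1 scalemx1.
  rewrite !det_mulmx mulrAC -det_mulmx -map_mxM PP map_mx1 det1.
  by rewrite mul1r.
rewrite char_poly_trig ?diag_mx_is_trig// big_image/=.
by apply: eq_bigr => i _; rewrite -spec_real// mxE eqxx mulr1n.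
Qed.

Lemma perm_eigenvalues M : M \is hermsymmx ->
  perm_eq (eigenvalues M) [seq spec M i | i : 'I_n].
Proof.
move=> hM; rewrite /eigenvalues perm_sort.
case: closed_field_poly_normal => s /= sE.
have /(perm_map (@complex.Re R)) : perm_eq s [seq (spec M i)%:C | i : 'I_n].
  apply: prod_XsubC_eq; rewrite -char_poly_spec// sE.
  by rewrite (monicP (char_poly_monic M)) scale1r.
by rewrite -map_comp.
Qed.

Lemma count_eigenvalues M (P : pred R) : M \is hermsymmx ->
  count P (eigenvalues M) = #|[set i | P (spec M i)]%SET|.
Proof.
move=> hM; rewrite (permP (perm_eigenvalues hM)) count_map.
by rewrite cardsE cardE size_filter /image_mem enumT.
Qed.

Lemma size_eigenvalues M : M \is hermsymmx -> size (eigenvalues M) = n.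
Proof.
move=> hM; by rewrite (perm_size (perm_eigenvalues hM)) size_map size_enum_ord.
Qed.

Lemma sorted_eigenvalues M : sorted <=%R (eigenvalues M).
Proof. by apply: sort_sorted; exact: le_total. Qed.

(** The eigenspace meets every hyperplane, that is, it has dimension at least
two.  This form is what is needed of a double eigenvalue: an eigenvector
vanishing at a prescribed site. *)
Definition double_eigenvalue M (x : R) : Prop :=
  forall h : 'cV[C]_n, exists u : 'rV[C]_n,
    [/\ u != 0, u *m M = x%:C *: u & u *m h = 0].

(** The linear conditions on a row vector that its coordinates outside S in the
eigenbasis be zero, as the columns of a matrix; listing exactly those columns
lets dimensions be counted by comparing sizes. *)
Definition annihilator M (S : {set 'I_n}) : 'M[C]_(n, #|~: S|) :=
  \matrix_(i, j) (spectralmx M)^t* i (enum_val j).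

Lemma annihilatorP M (S : {set 'I_n}) (u : 'rV[C]_n) : u *m annihilator M S = 0 ->
  forall i, i \notin S -> spec_coord M u 0 i = 0.
Proof.
move=> uS i iS; have iS' : i \in ~: S by rewrite inE.
have /rowP/(_ (enum_rank_in iS' i)) := uS; rewrite mxE [RHS]mxE => <-.
rewrite /spec_coord mxE; apply: eq_bigr => j _.
by rewrite [in RHS]mxE enum_rankK_in.
Qed.

(** Since a Hermitian matrix is unitarily diagonalizable, the dimension of an
eigenspace is the multiplicity of the eigenvalue in the list of eigenvalues. *)
Lemma double_eigenvalueP M x : M \is hermsymmx ->
  double_eigenvalue M x <-> (2 <= count (pred1 x) (eigenvalues M))%N.
Proof.
move=> hM; rewrite count_eigenvalues//; set S := [set i | _]%SET; split.
  move=> dM; rewrite leqNgt ltnS; apply/negP => S1.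
  pose h : 'cV[C]_n := \col_i
    if [pick j in S] is Some j then (spectralmx M)^t* i j else 0.
  have [u [u0 uM uh]] := dM h; case/negP: u0; apply/eqP.
  apply: (@spec_coord0 M); apply/rowP => i; rewrite [RHS]mxE.
  (* h reads off the only coordinate that an eigenvector can have *)
  have [iS|iS] := boolP (i \in S).
    move: uh => /matrixP/(_ 0 0); rewrite mxE [RHS]mxE => uh.
    rewrite /spec_coord mxE.
    rewrite -[RHS]uh; apply: eq_bigr => j _; congr (_ * _).
    rewrite [RHS]mxE; case: pickP => [k kS|/(_ i)]; last by rewrite iS.
    by have /card_le1_eqP/(_ _ _ iS kS)-> := S1.
  have := congr1 (fun w => spec_coord M w 0 i) uM.
  rewrite /= spec_coord_mul// mul_mx_diag mxE.
  rewrite {2}/spec_coord -scalemxAl -/(spec_coord M u) [RHS]mxE mulrC => /eqP.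
  rewrite -subr_eq0 -mulrBl mulf_eq0 => /orP[|/eqP//].
  rewrite spec_real// -rmorphB /= => /eqP/complexI/eqP; rewrite subr_eq0 => xi.
  by move: iS; rewrite inE /= xi.
move=> S2 h.
have [] := @nonzero_solution C n _ (row_mx (annihilator M S) h).
  move: S2 (cardsC S); rewrite card_ord => S2 nE.
  by rewrite -[ltnRHS]nE addn1 -addn2 addnC leq_add2r.
move=> u u0; rewrite mul_mx_row -[RHS]row_mx0 => /eq_row_mx[uS uh].
exists u; split=> //; have uE := annihilatorP uS.
rewrite {1}(spec_decomp hM) !mulmxA -/(spec_coord M u).
rewrite -[in RHS](spec_coordK M u) scalemxAl; congr (_ *m _).
apply/rowP => i; rewrite mul_mx_diag mxE [RHS]mxE mulrC.
have [iS|iS] := boolP (i \in S); last by rewrite uE// !mulr0.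
by rewrite spec_real//; move: iS; rewrite inE => /eqP->.
Qed.

Lemma support_neq0 M (S : {set 'I_n}) (u : 'rV[C]_n) : u != 0 ->
  (forall i, i \notin S -> spec_coord M u 0 i = 0) ->
  exists2 i, i \in S & 0 < sqmod (spec_coord M u 0 i).
Proof.
move=> u0 uS; have [/existsP[i ui]|/existsPn uz] :=
    boolP [exists i, spec_coord M u 0 i != 0].
  exists i; first by apply: contraNT ui => /uS->.
  rewrite lt_neqAle sqmod_ge0 andbT eq_sym; apply: contra ui.
  by move=> /eqP/sqmod_eq0->.
case/negP: u0; apply/eqP/(@spec_coord0 M)/rowP => i.
by rewrite [RHS]mxE; apply/eqP; have := uz i; rewrite negbK.
Qed.

(** Cauchy interlacing for two forms that agree on a hyperplane.  If the
eigenvalues of M1 in S1 lie below those of M2 in S2, then the corresponding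
spectral subspaces and the hyperplane h = 0 have no common nonzero vector, since
the common form would be at once smaller and larger; so their codimensions add up
to at least n. *)
Lemma interlacing_card M1 M2 (h : 'cV[C]_n) (S1 S2 : {set 'I_n}) :
  M1 \is hermsymmx -> M2 \is hermsymmx ->
  (forall u : 'rV[C]_n, u *m h = 0 ->
     (u *m M1 *m u^t*) 0 0 = (u *m M2 *m u^t*) 0 0) ->
  (forall i j, i \in S1 -> j \in S2 -> spec M1 i < spec M2 j) ->
  (#|S1| + #|S2| <= n.+1)%N.
Proof.
move=> hM1 hM2 eqM sep; rewrite leqNgt; apply/negP => big.
have [] := @nonzero_solution C n _
  (row_mx (row_mx (annihilator M1 S1) (annihilator M2 S2)) h).
  by have := cardsC S1; have := cardsC S2; rewrite !card_ord; lia.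
move=> u u0; rewrite !mul_mx_row -[RHS]row_mx0 => /eq_row_mx[+ uh].
rewrite -[RHS]row_mx0 => /eq_row_mx[/annihilatorP u1 /annihilatorP u2].
have /complexI Feq :=
  etrans (esym (herm_formE u hM1)) (etrans (eqM _ uh) (herm_formE u hM2)).
have /complexI Neq := etrans (esym (normE M1 u)) (normE M2 u).
have [i1 i1S i1u] := support_neq0 u0 u1.
have [i2 i2S i2u] := support_neq0 u0 u2.
have [m mS mmin] := arg_minP (fun j => spec M2 j) i2S.
have : spec M2 m * \sum_i sqmod (spec_coord M2 u 0 i)
    <= \sum_i spec M2 i * sqmod (spec_coord M2 u 0 i).
  rewrite mulr_sumr; apply: ler_sum => i _.
  have [iS|iS] := boolP (i \in S2); first by rewrite ler_wpM2r ?sqmod_ge0 ?mmin.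
  by rewrite u2// /sqmod/= expr0n/= addr0 !mulr0.
rewrite -Feq -Neq leNgt => /negP; apply.
rewrite mulr_sumr (bigD1 i1)//= [ltRHS](bigD1 i1)//= ltr_leD//.
  by rewrite ltr_pM2r// sep.
apply: ler_sum => i _; have [iS|iS] := boolP (i \in S1).
  by rewrite ler_wpM2r ?sqmod_ge0 ?ltW ?sep.
by rewrite u1// /sqmod/= expr0n/= addr0 !mulr0.
Qed.

End Spectral.

Section Interlacing.
Variables (R : realType) (n : nat).
Notation C := R[i].
Variables (M1 M2 : 'M[C]_n) (h : 'cV[C]_n).
Hypotheses (hM1 : M1 \is hermsymmx) (hM2 : M2 \is hermsymmx).
Hypothesis eqform : forall u : 'rV[C]_n, u *m h = 0 ->
  (u *m M1 *m u^t*) 0 0 = (u *m M2 *m u^t*) 0 0.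

Lemma interlacing_le (x : R) k :
  (k.+1 < count (fun y => (y <= x)%R) (eigenvalues M1))%N ->
  (eigenvalues M2)`_k <= x.
Proof.
move=> kc.
have arith (b c d : nat) :
  (k.+1 < b -> c + d = n -> b + d <= n.+1 -> k < c)%N by clear; lia.
apply: nth_le_of_count; first exact: sorted_eigenvalues.
have : (count (fun y => (y <= x)%R) (eigenvalues M1) +
    count (fun y => (x < y)%R) (eigenvalues M2) <= n.+1)%N.
  rewrite (count_eigenvalues (fun y => (y <= x)%R) hM1).
  rewrite (count_eigenvalues (fun y => (x < y)%R) hM2).
  apply: (interlacing_card hM1 hM2 eqform).
  by move=> i j; rewrite !inE => /le_lt_trans; exact.
have := count_predC (fun y => (y <= x)%R) (eigenvalues M2).
rewrite (size_eigenvalues hM2).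
rewrite (@eq_count _ (predC _) (fun y => (x < y)%R)); last first.
  by move=> y /=; rewrite ltNge.
by move=> E L; apply: arith kc E L.
Qed.

Lemma interlacing_ge (x : R) k : (k.+1 < n)%N ->
  (n <= k + count (fun y => (x <= y)%R) (eigenvalues M1))%N ->
  x <= (eigenvalues M2)`_k.+1.
Proof.
move=> kn kc.
have arith (b c d : nat) :
  (n <= k + b -> c + d = n -> d + b <= n.+1 -> n <= k.+1 + c)%N by clear; lia.
apply: nth_ge_of_count; rewrite ?(size_eigenvalues hM2);
  [exact: sorted_eigenvalues|exact: kn|].
have : (count (fun y => (y < x)%R) (eigenvalues M2) +
    count (fun y => (x <= y)%R) (eigenvalues M1) <= n.+1)%N.
  rewrite (count_eigenvalues (fun y => (x <= y)%R) hM1).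
  rewrite (count_eigenvalues (fun y => (y < x)%R) hM2).
  apply: (interlacing_card (h := h) hM2 hM1) => [u uh|]; first by rewrite eqform.
  by move=> i j; rewrite !inE => /lt_le_trans; exact.
have := count_predC (fun y => (x <= y)%R) (eigenvalues M2).
rewrite (size_eigenvalues hM2).
rewrite (@eq_count _ (predC _) (fun y => (y < x)%R)); last first.
  by move=> y /=; rewrite ltNge.
by move=> E L; apply: arith kc E L.
Qed.

End Interlacing.

(** The two counts are what [interlacing_le] and [interlacing_ge] ask for at the
index where a double eigenvalue sits. *)
Lemma double_eigenvalue_index (R : realType) n (M : 'M[R[i]]_n) (x : R) :
  M \is hermsymmx -> double_eigenvalue M x -> exists k,
  [/\ (k.+1 < n)%N, (eigenvalues M)`_k = x, (eigenvalues M)`_k.+1 = x,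
    (k.+1 < count (fun y => (y <= x)%R) (eigenvalues M))%N &
    (n <= k + count (fun y => (x <= y)%R) (eigenvalues M))%N].
Proof.
move=> hM /double_eigenvalueP => /(_ hM); set s := eigenvalues M => c2.
have ss : sorted <=%R s := sorted_eigenvalues M.
have sn : size s = n := size_eigenvalues hM.
have cle : count (fun y => (y <= x)%R) s =
    (count (fun y => (y < x)%R) s + count (pred1 x) s)%N.
  elim: s {c2 ss sn} => //= y s ->; rewrite le_eqVlt [LHS]/=.
  case: eqVneq => [->|_] /=.
    by rewrite ltxx addnCA.
  by rewrite add0n addnA.
have cge : n = (count (fun y => (y < x)%R) s + count (fun y => (x <= y)%R) s)%N.
  rewrite -sn -(count_predC (fun y => (y < x)%R) s); congr addn.
  by apply: eq_count => y /=; rewrite leNgt.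
(* k eigenvalues lie below x, so x occupies the positions k and k + 1 *)
set k := count (fun y => (y < x)%R) s.
have kc : (k.+1 < count (fun y => (y <= x)%R) s)%N.
  by rewrite cle -/k; move: c2; lia.
have kn : (k.+1 < n)%N by rewrite -sn (leq_trans kc)// count_size.
have xk : x <= s`_k.
  by apply: nth_ge_of_count => //; rewrite sn ?(ltnW kn)// -/k {1}cge.
have xkk : s`_k <= s`_k.+1.
  by rewrite (sorted_leq_nth le_trans le_refl)// inE sn// ltnW.
have kx : s`_k.+1 <= x by apply: nth_le_of_count.
exists k; split=> //.
- by apply/eqP; rewrite eq_le xk (le_trans xkk kx).
- by apply/eqP; rewrite eq_le kx (le_trans xk xkk).
- by rewrite {1}cge.
Qed.

(** * Floquet matrices and Bloch waves *)

Section Floquet.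
Variables (R : realType) (n : nat).
Notation C := R[i].
Notation p := n.+1.
Hypothesis n2 : (2 <= n)%N.
Implicit Types (a v : 'rV[R]_p) (theta x : R).

Lemma expi2piN theta : expi2pi (- theta) = Num.conj (expi2pi theta).
Proof. by rewrite /expi2pi mulrN cosN sinN. Qed.

Lemma expi2piV theta : expi2pi theta * expi2pi (- theta) = 1.
Proof.
rewrite expi2piN -[Num.conj _]/(complex.conjc _) -sqmodE /sqmod/=.
by rewrite cos2Dsin2.
Qed.

Lemma floquet_herm a v theta : floquet_mx a v theta \is hermsymmx.
Proof.
apply/is_hermitianmxP; rewrite expr0 scale1r; apply/matrixP => i j.
rewrite !mxE [j == i]eq_sym.
have cr (y : R) : Num.conj (y%:C) = y%:C by exact: conjc_real.
case: eqVneq => [->|ij]; first by rewrite cr.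
case: (eqVneq (j : nat) i.+1) => [ji|_].
  by rewrite ifF ?cr//; apply/negP => /eqP; lia.
case: eqVneq => [_|_]; first by rewrite cr.
case: ifP => [/andP[/eqP i0 /eqP jn]|ijN].
  rewrite ifF; last by rewrite i0 jn /=; lia.
  by rewrite i0 jn !eqxx /= rmorphM/= cr expi2piN.
case: ifP => [/andP[/eqP iN /eqP j0]|jiN].
  by rewrite iN j0 !eqxx /= rmorphM/= cr expi2piN conjCK.
rewrite ifF; last by rewrite andbC jiN.
by rewrite ifF ?rmorph0// andbC ijN.
Qed.

Lemma floquet_mulE a v theta (u : 'rV[C]_p) (j : 'I_p) :
  (u *m floquet_mx a v theta) 0 j = u 0 j * (v 0 j)%:C +
    (if j == 0 :> nat then u 0 ord_max * (expi2pi theta * (a 0 ord_max)%:C)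
     else u 0 (inord j.-1) * (a 0 (inord j.-1))%:C) +
    (if j == n :> nat then u 0 ord0 * (expi2pi (- theta) * (a 0 ord_max)%:C)
     else u 0 (inord j.+1) * (a 0 j)%:C).
Proof.
have jp := ltn_ord j.
rewrite mxE (bigD1 j)//= mxE eqxx -addrA; congr (_ + _).
(* the neighbours of j on the cycle; they are distinct because 2 <= n *)
pose jm : 'I_p := if j == 0 :> nat then ord_max else inord j.-1.
pose jq : 'I_p := if j == n :> nat then ord0 else inord j.+1.
have jmE : val jm = if j == 0 :> nat then n else j.-1.
  by rewrite /jm; case: eqP => //= _; rewrite inordK//; lia.
have jqE : val jq = if j == n :> nat then 0%N else j.+1.
  by rewrite /jq; case: eqP => //= jn; rewrite inordK//; lia.
have jm_j : jm != j by apply/eqP => /(congr1 val)/=; rewrite jmE; case: eqP; lia.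
have jq_j : (jq != j) && (jq != jm).
  by apply/andP; split; apply/eqP => /(congr1 val)/=; rewrite jqE ?jmE;
    do ?case: eqP; lia.
rewrite (bigD1 jm)//= (bigD1 jq)/=; last by case/andP: jq_j => -> ->.
rewrite big1 ?addr0; last first.
  move=> i /andP[/andP[ij im] iq].
  have {}im : val i <> (if j == 0 :> nat then n else j.-1).
    by rewrite -jmE => /val_inj/eqP; apply/negP.
  have {}iq : val i <> (if j == n :> nat then 0%N else j.+1).
    by rewrite -jqE => /val_inj/eqP; apply/negP.
  rewrite mxE (negbTE ij).
  have ip := ltn_ord i.
  have {}ij : val i <> j by move=> /val_inj/eqP; apply/negP.
  rewrite !ifF ?mulr0//; move: im iq ip jp ij => /=;
    do 2 case: eqP; rewrite ?eqE/=; lia.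
have jmE' := jmE; have jqE' := jqE.
congr (_ + _).
  rewrite mxE (negbTE jm_j); move: jmE'; rewrite /jm.
  have [j0|j0] := eqVneq (j : nat) 0%N => /= jmE'.
    by rewrite j0 !eqxx !ifF//; lia.
  rewrite jmE' ifT//; lia.
have jNq : jq == j = false by case/andP: jq_j => /negbTE.
rewrite mxE jNq; move: jqE'; rewrite /jq.
have [jn|jn] := eqVneq (j : nat) n => /= jqE'.
  have -> : j = ord_max by exact: val_inj.
  by rewrite ifF//=; lia.
rewrite jqE' ifF ?ifT//; lia.
Qed.

End Floquet.

Section Extension.
Variables (R : realType) (n : nat).
Notation C := R[i].
Notation p := n.+1.
Implicit Types (a v : 'rV[R]_p) (theta x : R) (z : C) (u : 'rV[C]_p).

Definition periodic_ext (a : 'rV[R]_p) (m : nat) : R := a 0 (inZp m).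

(** The Bloch wave of multiplier z whose values on the first period are u. *)
Definition bloch z u (m : nat) : C := z ^+ (m %/ p) * u 0 (inZp m).

Lemma periodic_extE a q r : (r < p)%N -> periodic_ext a (q * p + r) = a 0 (inord r).
Proof.
move=> rp; congr (a 0 _); apply: val_inj => /=.
by rewrite inordK// modnMDl modn_small.
Qed.

Lemma blochE z u q r : (r < p)%N ->
  bloch z u (q * p + r) = z ^+ q * u 0 (inord r).
Proof.
move=> rp; rewrite /bloch divnMDl// divn_small// addn0.
congr (_ * u 0 _); apply: val_inj => /=.
by rewrite inordK// modnMDl modn_small.
Qed.

Lemma blochD z u m : bloch z u (m + p) = z * bloch z u m.
Proof.
rewrite /bloch divnDr// divnn/= addn1 exprS mulrA; congr (_ * u 0 _).
by apply: val_inj; rewrite /= modnDr.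
Qed.

Lemma bloch_ord z u (i : 'I_p) : bloch z u i = u 0 i.
Proof. by rewrite /bloch divn_small// expr0 mul1r valZpK. Qed.

Lemma bloch_neq0 z u : u != 0 -> exists m, bloch z u m != 0.
Proof.
by move=> /rV0Pn[i ui]; exists i; rewrite bloch_ord.
Qed.

(** The recurrence at site m + 1, so that only sites in nat occur. *)
Definition jacobi_solution (A V : nat -> R) x (psi : nat -> C) : Prop :=
  forall m, (A m)%:C * psi m + (V m.+1)%:C * psi m.+1
    + (A m.+1)%:C * psi m.+2 = x%:C * psi m.+1.

(** Row eigenvectors pick up the inverse of the phase in the lower left corner,
whence the multiplier expi2pi (- theta). *)
Lemma bloch_solution a v theta x u : (2 <= n)%N ->
  u *m floquet_mx a v theta = x%:C *: u ->
  jacobi_solution (periodic_ext a) (periodic_ext v) x (bloch (expi2pi (- theta)) u).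
Proof.
move=> n2 uJ m; set z := expi2pi (- theta).
have zV : expi2pi theta * z = 1 := expi2piV theta.
pose q := (m.+1 %/ p)%N; pose r := (m.+1 %% p)%N.
have rp : (r < p)%N by rewrite ltn_mod.
have m1 : m.+1 = (q * p + r)%N by exact: divn_eq.
have E : z ^+ q * (u *m floquet_mx a v theta) 0 (inord r) =
  z ^+ q * (x%:C * u 0 (inord r)) by rewrite uJ mxE.
move: E; rewrite floquet_mulE// inordK// [RHS]mulrCA.
have psi1 : z ^+ q * u 0 (inord r) = bloch z u m.+1 by rewrite m1 blochE.
have v1 : v 0 (inord r) = periodic_ext v m.+1 by rewrite m1 periodic_extE.
rewrite psi1 => <-; rewrite !mulrDr [z ^+ q * (u 0 _ * _)]mulrA psi1 v1.
rewrite [bloch _ _ _ * _]mulrC [X in _ = X + _]addrC.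
congr (_ + _); first congr (_ + _).
  have [r0|r0] := eqVneq r 0%N.
    have [q' qE] : exists q', q = q'.+1.
      by exists q.-1; move: m1; rewrite r0; case: (q).
    have -> : m = (q' * p + n)%N by move: m1; rewrite r0 qE; lia.
    rewrite periodic_extE// blochE// qE exprSr.
    have -> : inord n = ord_max :> 'I_p by apply: val_inj; rewrite /= inordK.
    by rewrite -[LHS]mulr1 -zV; ring.
  have -> : m = (q * p + r.-1)%N by move: m1; lia.
  by rewrite periodic_extE ?blochE; [ring|lia|lia].
have [rn|rn] := eqVneq r n.
  have -> : m.+2 = (q.+1 * p + 0)%N by rewrite m1 rn; lia.
  rewrite m1 rn periodic_extE// blochE// exprSr.
  have -> : inord n = ord_max :> 'I_p by apply: val_inj; rewrite /= inordK.
  have -> : inord 0 = ord0 :> 'I_p by apply: val_inj; rewrite /= inordK.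
  by rewrite -/z; ring.
have -> : m.+2 = (q * p + r.+1)%N by rewrite m1; lia.
by rewrite m1 periodic_extE ?blochE; [ring|lia|lia].
Qed.

Lemma solution0 A V x psi k : (forall m, A m != 0) ->
  jacobi_solution A V x psi -> psi k = 0 -> psi k.+1 = 0 ->
  forall m, psi (k + m)%N = 0.
Proof.
move=> A0 S k0 k1 m; suff: psi (k + m)%N = 0 /\ psi (k + m.+1)%N = 0 by case.
elim: m => [|m [IH1 IH2]]; first by rewrite addn0 addn1.
split=> //; have := S (k + m)%N.
rewrite -!addnS IH1 IH2 !mulr0 !add0r => /eqP.
by rewrite mulf_eq0 (inj_eq (@complexI R) _ 0) (negbTE (A0 _)) => /eqP.
Qed.

Lemma bloch_solution_neq0 A V x z u k : (forall m, A m != 0) -> z != 0 ->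
  jacobi_solution A V x (bloch z u) -> u != 0 ->
  bloch z u k = 0 -> bloch z u k.+1 != 0.
Proof.
move=> A0 z0 S u0 k0; apply: contraNN u0 => /eqP k1.
have H := solution0 A0 S k0 k1; apply/eqP/rowP => i; rewrite mxE.
have Hk j : bloch z u (i + j * p) = z ^+ j * u 0 i.
  elim: j => [|j IH]; first by rewrite mul0n addn0 bloch_ord expr0 mul1r.
  by rewrite mulSnr addnA blochD IH exprS mulrA.
have : z ^+ k * u 0 i = 0.
  by rewrite -Hk -(H (i + k * n)%N); congr (bloch z u _); rewrite mulnS; lia.
by move/eqP; rewrite mulf_eq0 expf_eq0 (negbTE z0) andbF /= => /eqP.
Qed.

Lemma jacobi_solution_comb A V x psi phi b c :
  jacobi_solution A V x psi -> jacobi_solution A V x phi ->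
  jacobi_solution A V x (fun m => b * psi m - c * phi m).
Proof.
move=> S1 S2 m; have := S1 m; have := S2 m => E2 E1.
transitivity (b * (x%:C * psi m.+1) - c * (x%:C * phi m.+1)); last by ring.
by rewrite -E1 -E2; ring.
Qed.

Lemma wronskian A V x psi phi m :
  jacobi_solution A V x psi -> jacobi_solution A V x phi ->
  (A m)%:C * (psi m * phi m.+1 - psi m.+1 * phi m) =
  (A 0%N)%:C * (psi 0%N * phi 1%N - psi 1%N * phi 0%N).
Proof.
move=> S1 S2; elim: m => // m <-.
have E : (x%:C * psi m.+1) * phi m.+1 = psi m.+1 * (x%:C * phi m.+1) by ring.
move: E; rewrite -(S1 m) -(S2 m) => /eqP; rewrite -subr_eq0 => /eqP E.
by apply/eqP; rewrite -subr_eq0 -[X in _ == X]oppr0 -E; apply/eqP; ring.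
Qed.

(** The Wronskian is constant, but is multiplied by z1 * z2 over one period; if
it vanishes, the two waves are proportional and have the same multiplier. *)
Lemma bloch_multipliers A V x z1 z2 u1 u2 : (forall m, A m != 0) ->
  A p = A 0%N -> z1 != 0 -> z2 != 0 -> u1 != 0 -> u2 != 0 ->
  jacobi_solution A V x (bloch z1 u1) -> jacobi_solution A V x (bloch z2 u2) ->
  z1 = z2 \/ z1 * z2 = 1.
Proof.
move=> A0 Ap z10 z20 u10 u20 S1 S2.
set f := bloch z1 u1; set g := bloch z2 u2.
have fD : forall m, f (p + m)%N = z1 * f m by move=> m; rewrite addnC /f blochD.
have gD : forall m, g (p + m)%N = z2 * g m by move=> m; rewrite addnC /g blochD.
have := wronskian p S1 S2; rewrite -/f -/g Ap.
have fp : f p = z1 * f 0%N by rewrite -fD addn0.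
have fp1 : f p.+1 = z1 * f 1%N by rewrite -fD addn1.
have gp : g p = z2 * g 0%N by rewrite -gD addn0.
have gp1 : g p.+1 = z2 * g 1%N by rewrite -gD addn1.
rewrite fp fp1 gp gp1 => W.
have A0C : (A 0%N)%:C != 0 by rewrite (inj_eq (@complexI R) _ 0).
have : (A 0%N)%:C * ((z1 * z2 - 1) * (f 0%N * g 1%N - f 1%N * g 0%N)) = 0.
  by rewrite -(subrr ((A 0%N)%:C * (f 0%N * g 1%N - f 1%N * g 0%N))) -{1}W; ring.
move/eqP; rewrite mulf_eq0 (negbTE A0C) /= mulf_eq0 subr_eq0.
case/orP => [/eqP|]; [by right|rewrite subr_eq0 => /eqP w0; left].
have z12 i : (i <= 1)%N -> f i != 0 -> z1 = z2.
  move=> i1 fi.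
  have Sc := jacobi_solution_comb (g i) (f i) S1 S2.
  have c0 : g i * f 0%N - f i * g 0%N = 0.
    case: i i1 {fi Sc} => [|[|//]] _; first by ring.
    by rewrite [g 1%N * _]mulrC -w0; ring.
  have c1 : g i * f 1%N - f i * g 1%N = 0.
    case: i i1 {fi Sc c0} => [|[|//]] _; last by ring.
    by rewrite w0; ring.
  have c := solution0 A0 Sc c0 c1.
  have gi : g i != 0.
    have [m gm] := bloch_neq0 z2 u20; apply: contraNneq gm => gi.
    move: (c m); rewrite add0n gi mul0r sub0r => /eqP.
    by rewrite oppr_eq0 mulf_eq0 (negbTE fi).
  move: (c (p + i)%N); rewrite /= add0n -/f -/g fD gD => E.
  have {}E : (f i * g i) * (z1 - z2) = 0 by rewrite -E; ring.
  move/eqP: E; rewrite mulf_eq0 mulf_eq0 (negbTE fi) (negbTE gi)/=.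
  by rewrite subr_eq0 => /eqP.
have [f0|f0] := eqVneq (f 0%N) 0; last exact: (z12 0%N).
by apply: (z12 1%N) => //; apply: bloch_solution_neq0 S1 u10 f0.
Qed.

End Extension.

(** * Closed gaps and double eigenvalues *)

Section ClosedGap.
Variables (R : realType) (n : nat).
Notation C := R[i].
Notation p := n.+1.
Hypothesis n2 : (2 <= n)%N.
Implicit Types (a v : 'rV[R]_p) (theta x : R) (u : 'rV[C]_p).

Definition first_site : 'cV[C]_p := \col_i (i == ord0)%:R.

Lemma first_siteP u : u *m first_site = 0 -> u 0 ord0 = 0.
Proof.
move=> /matrixP/(_ 0 0); rewrite !mxE (bigD1 ord0)//= mxE eqxx mulr1.
by rewrite big1 ?addr0// => i /negbTE i0; rewrite mxE i0 mulr0.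
Qed.

(** Only the two corner entries depend on theta, and both involve site 0. *)
Lemma floquet_form a v theta1 theta2 u : u *m first_site = 0 ->
  (u *m floquet_mx a v theta1 *m u^t*) 0 0 =
  (u *m floquet_mx a v theta2 *m u^t*) 0 0.
Proof.
move=> /first_siteP u0; rewrite !mxE; apply: eq_bigr => j _.
have [->|j0] := eqVneq j ord0; first by rewrite !mxE u0 rmorph0 !mulr0.
congr (_ * _); rewrite !mxE; apply: eq_bigr => i _.
have [->|i0] := eqVneq i ord0; first by rewrite u0 !mul0r.
have i0' : i == 0 :> nat = false.
  by apply/negbTE; apply: contra i0 => /eqP i0; apply/eqP/val_inj.
have j0' : j == 0 :> nat = false.
  by apply/negbTE; apply: contra j0 => /eqP j0; apply/eqP/val_inj.
by rewrite !mxE i0' j0' andbF.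
Qed.

(** Interlacing with J(theta) puts the two bands adjacent to x on either side of
x for every other quasi-momentum, and both contain x. *)
Lemma double_eigenvalue_closed_gap a v theta x : theta \in `[0, 1] ->
  double_eigenvalue (floquet_mx a v theta) x -> closed_gap a v x.
Proof.
move=> t01 dx.
have hF t : floquet_mx a v t \is hermsymmx by exact: floquet_herm.
have [k [kp xk xk1 cle cge]] := double_eigenvalue_index (hF theta) dx.
exists k; split=> //; split.
- by exists theta; rewrite ?set_itvE//=; move: t01; rewrite in_itv.
- move=> _ [t _ <-]; rewrite /lambda_.
  exact: (interlacing_le (hF theta) (hF t) (floquet_form a v theta t) cle).
- by exists theta; rewrite ?set_itvE//=; move: t01; rewrite in_itv.
- move=> _ [t _ <-]; rewrite /lambda_.
  exact: (interlacing_ge (hF theta) (hF t) (floquet_form a v theta t) kp cge).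
Qed.

Lemma eigenvector_of_mem (M : 'M[C]_p) x : M \is hermsymmx ->
  x \in eigenvalues M -> exists2 u : 'rV[C]_p, u != 0 & u *m M = x%:C *: u.
Proof.
move=> hM; rewrite (perm_mem (perm_eigenvalues hM)) => /mapP[i _ ->].
pose P := spectralmx M.
have PP : P *m P^t* = 1%:M by apply/unitarymxP; exact: spectral_unitarymx.
exists (row i P).
  apply/eqP => P0; have := congr1 (fun w : 'M[C]_p => row i w) PP.
  rewrite /= row_mul P0 mul0mx => /rowP/(_ i); rewrite !mxE eqxx => /eqP.
  by rewrite eq_sym oner_eq0.
rewrite -row_mul [X in P *m X](spec_decomp hM) !mulmxA PP mul1mx.
by rewrite row_mul row_diag_mx -scalemxAl -rowE (spec_real _ hM).
Qed.

Lemma char_poly_tr (M : 'M[C]_p) : char_poly M^T = char_poly M.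
Proof.
rewrite /char_poly -[RHS]det_tr /char_poly_mx; congr (\det _).
by rewrite raddfB/= tr_scalar_mx map_trmx.
Qed.

Lemma eigenvalues_char_poly (M1 M2 : 'M[C]_p) :
  char_poly M1 = char_poly M2 -> eigenvalues M1 = eigenvalues M2.
Proof. by move=> E; rewrite /eigenvalues E. Qed.

Lemma eq_floquet a v theta1 theta2 :
  expi2pi theta1 = expi2pi theta2 :> C ->
  floquet_mx a v theta1 = floquet_mx a v theta2.
Proof. by move=> E; apply/matrixP => i j; rewrite !mxE !expi2piN E. Qed.

Lemma tr_floquet a v theta :
  (floquet_mx a v theta)^T = floquet_mx a v (- theta).
Proof.
have /is_hermitianmxP := floquet_herm n2 a v theta.
rewrite expr0 scale1r => /(congr1 trmx); rewrite map_trmx trmxK => ->.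
apply/matrixP => i j; rewrite !mxE.
have cr (y : R) : Num.conj (y%:C) = y%:C by exact: conjc_real.
by do ![case: ifP => _]; rewrite ?rmorphM /= ?expi2piN ?conjCK ?cr ?rmorph0 ?conjCK.
Qed.

(** Equal multipliers give equal matrices, inverse multipliers give transposed
ones. *)
Lemma floquet_eigenvalues_eq a v theta1 theta2 x : (forall i, 0 < a 0 i) ->
  x \in eigenvalues (floquet_mx a v theta1) ->
  x \in eigenvalues (floquet_mx a v theta2) ->
  eigenvalues (floquet_mx a v theta1) = eigenvalues (floquet_mx a v theta2).
Proof.
move=> a0 /(eigenvector_of_mem (floquet_herm n2 _ _ _))[u1 u10].
move=> /(bloch_solution n2) S1.
move=> /(eigenvector_of_mem (floquet_herm n2 _ _ _))[u2 u20].
move=> /(bloch_solution n2) S2.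
have A0 (m : nat) : periodic_ext a m != 0 by exact: (lt0r_neq0 (a0 _)).
have Ap : periodic_ext a p = periodic_ext a 0%N.
  by congr (a 0 _); apply: val_inj; rewrite /= modnn.
have z0 (t : R) : expi2pi (- t) != 0 :> C.
  by apply/eqP => z; have /eqP := expi2piV t; rewrite z mulr0 eq_sym oner_eq0.
apply: eigenvalues_char_poly.
have [E|E] := bloch_multipliers A0 Ap (z0 _) (z0 _) u10 u20 S1 S2.
  congr char_poly; apply: eq_floquet; move: E; rewrite !expi2piN.
  exact: (can_inj conjCK).
rewrite -char_poly_tr tr_floquet; congr char_poly; apply: eq_floquet.
apply: (mulIf (z0 theta2)); rewrite E.
by rewrite expi2piV.
Qed.

Lemma closed_gap_double_eigenvalue a v x : (forall i, 0 < a 0 i) ->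
  closed_gap a v x -> exists theta, double_eigenvalue (floquet_mx a v theta) x.
Proof.
move=> a0 [j [jp [[t1 _ x1] _] [[t2 _ x2] _]]].
have hF t : floquet_mx a v t \is hermsymmx by exact: floquet_herm.
exists t1; apply/double_eigenvalueP => //.
have E : eigenvalues (floquet_mx a v t1) = eigenvalues (floquet_mx a v t2).
  apply: (@floquet_eigenvalues_eq _ _ _ _ x) => //.
    by rewrite -x1 /lambda_ mem_nth// size_eigenvalues// ltnW.
  by rewrite -x2 /lambda_ mem_nth// size_eigenvalues.
apply: (count_pair _ x1); first by rewrite (size_eigenvalues (hF t1)).
rewrite E; exact: x2.
Qed.

End ClosedGap.

(** * Continuants *)

(** The characteristic polynomial of the Jacobi matrix cut down to the sites
k, ..., k + m - 1, by expansion along the last row. *)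
Fixpoint continuant (R : nzRingType) (A V : nat -> R) (k m : nat) : {poly R} :=
  if m is m1.+1 then
    ('X - (V (k + m1)%N)%:P) * continuant A V k m1 -
    (if m1 is m2.+1 then A (k + m2)%N ^+ 2 *: continuant A V k m2 else 0)
  else 1.

Section Continuant.
Variables (R : comNzRingType) (A V : nat -> R).
Notation K := (continuant A V).

Lemma continuant1 k : K k 1 = 'X - (V k)%:P.
Proof. by rewrite /= addn0 mulr1 subr0. Qed.

Lemma continuantSS k m :
  K k m.+2 = ('X - (V (k + m.+1)%N)%:P) * K k m.+1 - A (k + m)%N ^+ 2 *: K k m.
Proof. by []. Qed.

Lemma coef_continuantSS k m j : (K k m.+2)`_j.+1 =
  (K k m.+1)`_j - V (k + m.+1)%N * (K k m.+1)`_j.+1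
  - A (k + m)%N ^+ 2 * (K k m)`_j.+1.
Proof. by rewrite continuantSS coefB coefZ mulrBl coefB coefXM coefCM. Qed.

Lemma continuant_gt k m j : (m < j)%N -> (K k m)`_j = 0.
Proof.
have [N] := ubnP m; elim: N m j => // N IH [|[|m]] [|j]// mN mj.
- by rewrite coef1.
- by rewrite continuant1 coefB coefX coefC/=; case: j mj => //= j _; rewrite subr0.
rewrite coef_continuantSS !IH ?mulr0 ?subr0//; lia.
Qed.

Lemma continuant_lead k m : (K k m)`_m = 1.
Proof.
elim: m => [|[|m] IH]; first by rewrite coef1.
  by rewrite continuant1 coefB coefX coefC subr0.
by rewrite coef_continuantSS IH !continuant_gt// !mulr0 !subr0.
Qed.

Lemma size_continuant k m : size (K k m) = m.+1.
Proof.
apply/eqP; rewrite eqn_leq; apply/andP; split.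
  by apply/leq_sizeP => j; exact: continuant_gt.
rewrite ltnNge; apply/negP => /leq_sizeP/(_ _ (leqnn m)).
by rewrite continuant_lead => /eqP; rewrite oner_eq0.
Qed.

Lemma continuant_coef1 k m :
  (K k m.+1)`_m = - \sum_(i < m.+1) V (k + i)%N.
Proof.
elim: m => [|m IH].
  by rewrite continuant1 coefB coefX coefC big_ord1 addn0 sub0r.
rewrite coef_continuantSS IH continuant_lead continuant_gt// mulr0 mulr1 subr0.
by rewrite [in RHS]big_ord_recr/= opprD.
Qed.

Lemma continuant_coef2 k m : (forall i, V i = 0) ->
  (K k m.+2)`_m = - \sum_(i < m.+1) A (k + i)%N ^+ 2.
Proof.
move=> V0; elim: m => [|m IH].
  rewrite continuantSS continuant1 coefB coefZ coef1 mulr1.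
  by rewrite !V0 !subr0 coefXM/= big_ord1 sub0r.
rewrite coef_continuantSS IH V0 mul0r subr0 continuant_lead mulr1.
by rewrite [in RHS]big_ord_recr/= opprD.
Qed.

Lemma sum_window_sub (f : nat -> R) k m :
  \sum_(i < m.+1) f (k + i)%N = \sum_(i < m.+1) f (k.+1 + i)%N ->
  f k = f (k + m.+1)%N.
Proof.
rewrite big_ord_recl big_ord_recr/= addn0 addSnnS [RHS]addrC.
under [X in _ = _ + X]eq_bigr do rewrite addSnnS.
by move/addIr.
Qed.

End Continuant.

(** Both sides satisfy the same recurrence in m: a solution that vanishes at k is
determined by its value at k + 1. *)
Lemma continuant_solution (R : realType) (A V : nat -> R) x
  (psi : nat -> R[i]) k m :
  jacobi_solution A V x psi -> psi k = 0 ->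
  (\prod_(i < m) A (k.+1 + i)%N)%:C * psi (k.+1 + m)%N =
  (continuant A V k.+1 m).[x]%:C * psi k.+1.
Proof.
move=> S k0; suff : forall m,
  (\prod_(i < m) A (k.+1 + i)%N)%:C * psi (k.+1 + m)%N =
    (continuant A V k.+1 m).[x]%:C * psi k.+1 /\
  (\prod_(i < m.+1) A (k.+1 + i)%N)%:C * psi (k.+1 + m.+1)%N =
    (continuant A V k.+1 m.+1).[x]%:C * psi k.+1 by move=> /(_ m)[].
elim=> [|{}m [IH1 IH2]].
  split; first by rewrite big_ord0 addn0 hornerC.
  rewrite big_ord1 addn0 addn1 continuant1 hornerXsubC rmorphB/= mulrBl.
  by rewrite -(S k) k0; ring.
split=> //.
have -> : (continuant A V k.+1 m.+2).[x] =
    (x - V (k.+1 + m.+1)%N) * (continuant A V k.+1 m.+1).[x] -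
    A (k.+1 + m)%N * A (k.+1 + m)%N * (continuant A V k.+1 m).[x].
  by rewrite continuantSS hornerD hornerN hornerM hornerZ hornerXsubC expr2.
rewrite rmorphB !rmorphM mulrBl -[X in _ = X - _]mulrA -[X in _ = _ - X]mulrA.
rewrite -IH1 -IH2 rmorphB/=.
have := S (k.+1 + m)%N; rewrite -!addnS => E.
rewrite big_ord_recr [in RHS]big_ord_recr !rmorphM/=.
rewrite big_ord_recr rmorphM/= -[LHS]mulrA.
have -> : (A (k.+1 + m.+1)%N)%:C * psi (k.+1 + m.+2)%N =
  x%:C * psi (k.+1 + m.+1)%N - (A (k.+1 + m)%N)%:C * psi (k.+1 + m)%N -
  (V (k.+1 + m.+1)%N)%:C * psi (k.+1 + m.+1)%N by rewrite -E; ring.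
by ring.
Qed.

(** * Irreducibility and counting *)

Section Cyclic.
Variables (R : realType) (n : nat).
Notation p := n.+1.
Implicit Types (v : 'rV[R]_p).

Lemma periodic_extD v m : periodic_ext v (m + p) = periodic_ext v m.
Proof. by congr (v 0 _); apply: val_inj; rewrite /= modnDr. Qed.

Lemma periodic_ext_ord v (i : 'I_p) : periodic_ext v i = v 0 i.
Proof. by rewrite /periodic_ext valZpK. Qed.

Lemma periodic_ext_mod v m l : periodic_ext v (m %% p + l) = periodic_ext v (m + l).
Proof. by congr (v 0 _); apply: val_inj; rewrite /= modnDml. Qed.

Lemma iter_cyc v m i : iter m (@cyc R p) v 0 i = periodic_ext v (i + m).
Proof.
elim: m i => [|m IH] i; first by rewrite addn0 periodic_ext_ord.
by rewrite iterS mxE IH /= periodic_ext_mod addSnnS.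
Qed.

Lemma irreducibleE v : irreducible v <->
  forall m, (0 < m < p)%N -> ~ (forall k, periodic_ext v (k + m) = periodic_ext v k).
Proof.
split=> [irr m /andP[m0 mp] vm|H].
  have /(congr1 val)/= : Ordinal mp = ord0 :> 'I_p; last by move: m0; case: (m).
  by apply: irr; apply/rowP => i; rewrite /= iter_cyc vm periodic_ext_ord.
move=> k l; wlog kl : k l / (k <= l)%N.
  by move=> W; have [/W//|/ltnW/W klE /esym/klE/esym] := leqP k l.
move=> E; apply/val_inj/eqP => /=; rewrite eqn_leq kl leqNgt.
apply/negP => lk.
apply: (H (l - k)%N); first by have := ltn_ord l; lia.
move=> j; have /rowP/(_ (inZp (j + (p - k)))) := E.
rewrite !iter_cyc !periodic_ext_mod.
have -> : (j + (p - k) + k = j + p)%N by have := ltn_ord k; lia.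
have -> : (j + (p - k) + l = j + (l - k) + p)%N by have := ltn_ord k; lia.
by rewrite !periodic_extD.
Qed.

End Cyclic.

Section Counting.
Variables (R : realType) (n : nat).
Notation p := n.+1.
Implicit Types (a v : 'rV[R]_p).

Lemma finite_closed_gap a v : finite_set (closed_gap a v).
Proof.
apply: (@sub_finite_set _ _
  ((fun j => xget 0 [set m | is_max (band a v j) m]) @` `I_p)); last first.
  exact/finite_image/finite_II.
move=> x [j [jp jmax jmin]]; exists j; first exact: ltnW.
case: xgetP => [y _ [yj uy]|/(_ x)//].
by apply/eqP; rewrite eq_le; case: jmax => xj ux; rewrite ux// uy.
Qed.

Lemma ngaps_lt_size a v (q : {poly R}) : q != 0 ->
  (forall x, closed_gap a v x -> root q x) -> (ngaps a v < size q)%N.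
Proof.
move=> q0 qx; rewrite /ngaps; apply: (max_poly_roots q0); last exact: fset_uniq.
apply/allP => x; rewrite in_fset_set; last exact: finite_closed_gap.
by rewrite inE; exact: qx.
Qed.

Lemma ngaps_ge1 a v x : closed_gap a v x -> (1 <= ngaps a v)%N.
Proof.
move=> gx; rewrite /ngaps cardfs_gt0; apply/fset0Pn; exists x.
by rewrite in_fset_set ?inE//; exact: finite_closed_gap.
Qed.

Lemma ngaps_ge2 a v x y : closed_gap a v x -> closed_gap a v y -> x != y ->
  (2 <= ngaps a v)%N.
Proof.
move=> gx gy xy; have := cardfs2 x y; rewrite xy => <-.
apply: fsubset_leq_card; apply/fsubsetP => z.
rewrite !inE in_fset_set; last exact: finite_closed_gap.
by case/orP => /eqP->; rewrite inE.
Qed.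

End Counting.

Lemma le_max_nat (S : set nat) N m :
  (forall s, S s -> (s <= N)%N) -> S m -> (m <= max_nat S)%N.
Proof.
move=> SN Sm; have exS : exists k, `[< S k >] by exists m; apply/asboolP.
have SN' k : `[< S k >] -> (k <= N)%N by move=> /asboolP/SN.
have : is_max S (max_nat S).
  apply: (@xgetPex _ 0%N [set k | is_max S k]).
  have [k /asboolP Sk kmax] := ex_maxnP exS SN'.
  by exists k; split=> // j Sj; rewrite leEnat kmax//; apply/asboolP.
by case=> _ /(_ _ Sm).
Qed.

Lemma max_nat_le (S : set nat) N :
  (forall s, S s -> (s <= N)%N) -> (max_nat S <= N)%N.
Proof. by move=> SN; rewrite /max_nat; case: xgetP => // m _ [/SN]. Qed.

(** * Upper bounds *)

Section UpperBounds.
Variables (R : realType) (n : nat).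
Hypothesis n2 : (2 <= n)%N.
Notation p := n.+1.
Notation C := R[i].
Implicit Types (a v : 'rV[R]_p).

(** The multiplier z is the same for all sites k, although the wave is not. *)
Lemma closed_gap_solution a v x : (forall i, 0 < a 0 i) -> closed_gap a v x ->
  exists z : C, forall k, exists psi : nat -> C,
  [/\ jacobi_solution (periodic_ext a) (periodic_ext v) x psi,
    forall m, psi (m + p)%N = z * psi m, psi k = 0 & psi k.+1 != 0].
Proof.
move=> a0 /(closed_gap_double_eigenvalue n2 a0)[theta dx].
exists (expi2pi (- theta)) => k.
have [u [u0 uJ uk]] := dx (\col_i (i == inZp k)%:R).
exists (bloch (expi2pi (- theta)) u).
have S := bloch_solution n2 uJ.
have k0 : bloch (expi2pi (- theta)) u k = 0.
  rewrite /bloch (_ : u 0 (inZp k) = 0) ?mulr0//.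
  move: uk => /matrixP/(_ 0 0); rewrite !mxE (bigD1 (inZp k))//= mxE eqxx mulr1.
  by rewrite big1 ?addr0// => i /negbTE i0; rewrite mxE i0 mulr0.
split=> //; first by move=> m; exact: blochD.
apply: bloch_solution_neq0 S u0 k0.
- by move=> m; exact: (lt0r_neq0 (a0 _)).
- by apply/eqP => z; have /eqP := expi2piV theta; rewrite z mulr0 eq_sym oner_eq0.
Qed.

Lemma closed_gap_dirichlet a v x k : (forall i, 0 < a 0 i) ->
  closed_gap a v x -> root (continuant (periodic_ext a) (periodic_ext v) k.+1 n) x.
Proof.
move=> a0 /(closed_gap_solution a0)[z /(_ k)[psi [S D k0 k1]]].
have /esym/eqP := continuant_solution n S k0; rewrite addSnnS D k0 !mulr0.
by rewrite mulf_eq0 (negbTE k1) orbF (inj_eq (@complexI R) _ 0).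
Qed.

(** The wave that vanishes at k satisfies psi (k + p - 1) = - psi (k + p + 1)
= - z * psi (k + 1), so that both continuants take the value - z. *)
Lemma closed_gap_monodromy v x k : closed_gap (const_mx 1) v x ->
  let K := continuant (periodic_ext (const_mx 1 : 'rV[R]_p)) (periodic_ext v) in
  root (K k.+1 n.-1 - K k.+2 n.-1) x.
Proof.
set a : 'rV[R]_p := const_mx 1 => gx /=.
have a1 m : periodic_ext a m = 1 by rewrite /periodic_ext mxE.
have a0 i : 0 < a 0 i by rewrite mxE.
have [z Hz] := closed_gap_solution a0 gx.
have Kz j : (continuant (periodic_ext a) (periodic_ext v) j.+1 n.-1).[x]%:C = - z.
  have [psi [S D j0 j1]] := Hz j.
  apply: (mulIf j1); rewrite -(continuant_solution n.-1 S j0).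
  rewrite big1 ?mul1r; last by move=> i _; rewrite a1.
  have -> : (j.+1 + n.-1 = j + n)%N by lia.
  have := S (j + n)%N; rewrite !a1 -!addnS D j0 !mulr0 addr0 !mul1r.
  by rewrite addnS -addSn D mulNr => /eqP; rewrite addr_eq0 => /eqP.
rewrite /root hornerD hornerN subr_eq0.
by apply/eqP/(@complexI R); rewrite !Kz.
Qed.

(** Modulo p the equation reads V (k + 1) = V (k - 1), so that the shift by two
sites fixes v. *)
Lemma irreducible_shift v : irreducible v ->
  ~ (forall k, periodic_ext v k.+1 = periodic_ext v (k + n)).
Proof.
move=> /irreducibleE irr H; apply: (irr n.-1); first by lia.
move=> k; rewrite -[in LHS]periodic_extD -[RHS]periodic_extD.
have -> : (k + n.-1 + p = (k + n) + n)%N by lia.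
by rewrite -H addnS.
Qed.

(** Both continuants have degree n - 1 and are monic, so their difference has at
most n - 2 roots unless it vanishes. *)
Lemma ngapsDSO_le v : irreducible v -> (ngapsDSO v <= n - 2)%N.
Proof.
move=> irr; rewrite leqNgt; apply/negP => big.
apply: (irreducible_shift irr) => k.
pose K := continuant (periodic_ext (const_mx 1 : 'rV[R]_p)) (periodic_ext v).
have sK : (size (K k.+1 n.-1 - K k.+2 n.-1)%R <= n.-1)%N.
  apply/leq_sizeP => j; rewrite leq_eqVlt coefB => /orP[/eqP<-|jn].
    by rewrite !continuant_lead subrr.
  by rewrite !continuant_gt// subrr.
have /eqP : K k.+1 n.-1 - K k.+2 n.-1 = 0.
  apply/eqP/negPn/negP => q0.
  suff : (ngapsDSO v < n.-1)%N by lia.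
  by apply: leq_trans sK; apply: ngaps_lt_size => // x; exact: closed_gap_monodromy.
rewrite subr_eq0 => /eqP.
(* the next coefficient is minus the sum of the potential over a window *)
have -> : n.-1 = (n - 2).+1 by lia.
move=> /(congr1 (fun q : {poly R} => q`_(n - 2))).
rewrite !continuant_coef1 => /oppr_inj/sum_window_sub ->.
by congr periodic_ext; lia.
Qed.

(** With zero diagonal the two leading coefficients of a continuant of degree n
are 1 and 0, so again a nonzero difference has at most n - 2 roots; the next
coefficient is minus the sum of the squared weights over a window. *)
Lemma ngapsODJM_le a : (forall i, 0 < a 0 i) -> irreducible a ->
  (ngapsODJM a <= n - 2)%N.
Proof.
move=> a0 irr; rewrite leqNgt; apply/negP => big.
apply: (irreducible_shift irr) => k.
pose K := continuant (periodic_ext a) (periodic_ext (0 : 'rV[R]_p)).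
have V0 i : periodic_ext (0 : 'rV[R]_p) i = 0 by rewrite /periodic_ext mxE.
have nE : n = (n - 2).+2 by lia.
have sK : (size (K k.+1 n - K k.+2 n)%R <= n.-1)%N.
  apply/leq_sizeP => j; rewrite leq_eqVlt coefB => /orP[/eqP<-|].
    (* the trace vanishes because the diagonal does *)
    have c1 j' : (K j' n)`_n.-1 = 0.
      have := continuant_coef1 (periodic_ext a)
        (periodic_ext (0 : 'rV[R]_p)) j' n.-1.
      by rewrite big1 ?oppr0// prednK//; lia.
    by rewrite !c1 subrr.
  rewrite leq_eqVlt => /orP[/eqP jn|jn].
    have -> : j = n by lia.
    by rewrite !continuant_lead subrr.
  by rewrite !continuant_gt ?subrr//; lia.
have /eqP : K k.+1 n - K k.+2 n = 0.
  apply/eqP/negPn/negP => q0.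
  suff : (ngapsODJM a < n.-1)%N by lia.
  apply: leq_trans sK; apply: ngaps_lt_size => // x gx.
  rewrite /root hornerD hornerN (rootP (closed_gap_dirichlet k a0 gx)).
  by rewrite (rootP (closed_gap_dirichlet k.+1 a0 gx)) subrr.
rewrite subr_eq0 {1 2}nE => /eqP/(congr1 (fun q : {poly R} => q`_(n - 2))).
rewrite !continuant_coef2// => /oppr_inj.
move=> /(sum_window_sub (f := fun m => periodic_ext a m ^+ 2))/eqP.
rewrite eqrXn2 ?ltW//; try exact: a0.
by move=> /eqP ->; congr periodic_ext; lia.
Qed.

End UpperBounds.

(** * Lower bounds from fan triangulations *)

Section Examples.
Variables (R : realType) (n : nat).
Hypothesis n6 : (6 <= n)%N.
Notation p := n.+1.
Notation C := R[i].
Implicit Types (a v : 'rV[R]_p) (s x : R) (f : nat -> R).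

Let n2 : (2 <= n)%N := leq_trans (isT : (2 <= 6)%N) n6.

Lemma double_eigenvalue_of_pair (M : 'M[C]_p) x (u1 u2 : 'rV[C]_p) i :
  u1 *m M = x%:C *: u1 -> u2 *m M = x%:C *: u2 ->
  u1 != 0 -> u1 0 i = 0 -> u2 0 i != 0 -> double_eigenvalue M x.
Proof.
move=> u1M u2M u10 u1i u2i h; pose s (u : 'rV[C]_p) : C := (u *m h) 0 0.
have sE (u : 'rV[C]_p) : u *m h = (s u)%:M by rewrite [LHS]mx11_scalar.
have [s0|s0] := eqVneq (s u1) 0.
  by exists u1; split=> //; rewrite sE s0 raddf0.
exists (s u2 *: u1 - s u1 *: u2); split.
- apply/eqP => /rowP/(_ i)/eqP; rewrite !mxE u1i mulr0 sub0r oppr_eq0 mulf_eq0.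
  by rewrite (negbTE s0) (negbTE u2i).
- rewrite mulmxBl -!scalemxAl u1M u2M scalerBr !scalerA.
  by rewrite [s u2 * _]mulrC [s u1 * _]mulrC.
- by rewrite mulmxBl -!scalemxAl !sE !scale_scalar_mx mulrC subrr.
Qed.

Definition site_row f : 'rV[C]_p := \row_i (f i)%:C.

(** The eigenvalue equation of J(theta) on real vectors when the phase
expi2pi theta is a real sign s. *)
Definition real_floquet_eq (A V : nat -> R) s x f : Prop :=
  forall j, (j <= n)%N ->
  V j * f j + (if j == 0%N then s * A n * f n else A j.-1 * f j.-1) +
  (if j == n then s * A n * f 0%N else A j * f j.+1) = x * f j.

Lemma real_floquet_eigenvector a v theta s x f :
  expi2pi theta = s%:C -> expi2pi (- theta) = s%:C ->
  real_floquet_eq (periodic_ext a) (periodic_ext v) s x f ->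
  site_row f *m floquet_mx a v theta = x%:C *: site_row f.
Proof.
move=> ts tNs H; apply/rowP => j; have jn : (j <= n)%N by rewrite -ltnS.
have am : a 0 ord_max = periodic_ext a n.
  by congr (a 0 _); apply: val_inj; rewrite /= modn_small.
rewrite floquet_mulE// !mxE ts tNs am -[in RHS]rmorphM -(H j jn) periodic_ext_ord.
rewrite !rmorphD rmorphM [(f j)%:C * _]mulrC; congr (_ + _ + _).
  case: eqP => [_|j0]; first by rewrite !rmorphM mulrC.
  have j1 : (j.-1 < p)%N by lia.
  rewrite inordK// rmorphM mulrC; congr ((a 0 _)%:C * _).
  by apply: val_inj; rewrite /= inordK// modn_small.
case: eqP => [_|jn']; first by rewrite !rmorphM mulrC.
by rewrite inordK ?periodic_ext_ord ?rmorphM 1?mulrC//; lia.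
Qed.

Lemma real_closed_gap a v theta s x f1 f2 : theta \in `[0, 1] ->
  expi2pi theta = s%:C -> expi2pi (- theta) = s%:C ->
  real_floquet_eq (periodic_ext a) (periodic_ext v) s x f1 ->
  real_floquet_eq (periodic_ext a) (periodic_ext v) s x f2 ->
  f1 0%N = 0 -> f1 1%N != 0 -> f2 0%N != 0 -> closed_gap a v x.
Proof.
move=> t01 ts tNs H1 H2 f10 f11 f20.
apply: (double_eigenvalue_closed_gap n2 t01).
have CN0 (y : R) : (y%:C == 0) = (y == 0) by rewrite (inj_eq (@complexI R) _ 0).
apply: (double_eigenvalue_of_pair (i := ord0)
  (real_floquet_eigenvector ts tNs H1) (real_floquet_eigenvector ts tNs H2)).
- apply/rV0Pn; exists (inord 1); rewrite mxE inordK ?CN0//; lia.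
- by rewrite mxE f10.
- by rewrite mxE CN0.
Qed.

Lemma expi2pi_half : expi2pi (2^-1 : R) = (- 1)%:C.
Proof. by rewrite /expi2pi mulrAC divff// mul1r cospi sinpi. Qed.

Lemma expi2piN_half : expi2pi (- 2^-1 : R) = (- 1)%:C.
Proof. by rewrite expi2piN expi2pi_half; exact: conjc_real. Qed.

Lemma expi2pi0 : expi2pi (0 : R) = 1%:C.
Proof. by rewrite /expi2pi mulr0 cos0 sin0. Qed.

(** Number of triangles at the vertex m of a p-gon, p = n + 1, triangulated by
the diagonals from the vertex 0. *)
Definition fan (m : nat) : nat :=
  if m == 0%N then n.-1 else if (m == 1%N) || (m == n) then 1%N else 2.

Definition fan_sol1 (m : nat) : R := (m != 0%N)%:R.
Definition fan_sol2 (m : nat) : R := if m == 0%N then 1 else 1 - m%:R.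

(** The signs at the two ends make f antiperiodic. *)
Definition frieze_eq f : Prop := forall j, (j <= n)%N ->
  (if j == 0%N then - f n else f j.-1) + (if j == n then - f 0%N else f j.+1)
    = (fan j)%:R * f j.

Lemma fan_sol1P : frieze_eq fan_sol1.
Proof.
move=> j jn; rewrite /fan_sol1 /fan.
have n0 : n == 0%N = false by lia.
have [->|j0] := eqVneq j 0%N; first by rewrite n0 eq_sym n0 mulr0 addNr.
have [->|j1] := eqVneq j 1%N.
  by have -> : 1%N == n = false by [lia]; rewrite /= add0r mul1r.
have j1' : j.-1 != 0%N by lia.
have [->|jn'] := eqVneq j n; last by rewrite j1' /= mulr1.
by rewrite /= subr0 mul1r; have -> : n.-1 != 0%N by [lia].
Qed.

Lemma fan_sol2P : frieze_eq fan_sol2.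
Proof.
have predR m : (0 < m)%N -> m.-1%:R = m%:R - 1 :> R.
  by move=> m0; rewrite -subn1 natrB.
move=> j jn; rewrite /fan_sol2 /fan.
have n0 : n == 0%N = false by lia.
have [->|j0] := eqVneq j 0%N.
  by rewrite n0 eq_sym n0 /= predR; [ring|lia].
have [->|j1] := eqVneq j 1%N.
  by have -> : 1%N == n = false by [lia]; rewrite /= mul1r; ring.
have -> : j.-1 == 0%N = false by lia.
rewrite predR; last by lia.
have [->|jn'] := eqVneq j n => /=; first by ring.
by rewrite -[j.+1]addn1 natrD; ring.
Qed.

Definition fan_potential : 'rV[R]_p := \row_i - (fan i)%:R.

Lemma fan_potentialE m : (m <= n)%N -> periodic_ext fan_potential m = - (fan m)%:R.
Proof. by move=> mn; rewrite /periodic_ext mxE /= modn_small. Qed.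

Lemma fan_potential_eq f : frieze_eq f ->
  real_floquet_eq (periodic_ext (const_mx 1 : 'rV[R]_p))
    (periodic_ext fan_potential) (- 1) 0 f.
Proof.
move=> H j jn; rewrite fan_potentialE// mulNr -H//.
have a1 m : periodic_ext (const_mx 1 : 'rV[R]_p) m = 1 by rewrite /periodic_ext mxE.
by rewrite !a1; do 2 case: ifP => _; ring.
Qed.

Lemma fan_potential_closed_gap : closed_gap (const_mx 1) fan_potential 0.
Proof.
apply: (real_closed_gap (theta := 2^-1) (s := -1) _ expi2pi_half expi2piN_half
  (fan_potential_eq fan_sol1P) (fan_potential_eq fan_sol2P)).
- by rewrite in_itv/=; lra.
- by [].
- by rewrite oner_eq0.
- by rewrite oner_eq0.
Qed.

Lemma fan_potential_irreducible : irreducible fan_potential.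
Proof.
apply/irreducibleE => m /andP[m0 mp] /(_ 0%N).
rewrite !fan_potentialE// add0n => /oppr_inj/eqP; rewrite eqr_nat /fan /=.
by rewrite [m == 0%N]gtn_eqF//; case: ifP => _ /eqP; lia.
Qed.

Definition fan_edge (m : nat) : nat := (fan m * fan (m.+1 %% p))%N.

Definition fan_weight : 'rV[R]_p := \row_i (Num.sqrt (fan_edge i)%:R)^-1.

Lemma fan_gt0 m : (0 < fan m)%N.
Proof. by rewrite /fan; do ?case: ifP => _; lia. Qed.

Lemma fan_edge_gt0 m : (0 < fan_edge m)%N.
Proof. by rewrite muln_gt0 !fan_gt0. Qed.

Lemma fan_weight_gt0 i : 0 < fan_weight 0 i.
Proof. by rewrite mxE invr_gt0 sqrtr_gt0 ltr0n fan_edge_gt0. Qed.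

Lemma fan_weightE m : (m <= n)%N ->
  periodic_ext fan_weight m = (Num.sqrt (fan_edge m)%:R)^-1.
Proof. by move=> mn; rewrite /periodic_ext mxE /= modn_small. Qed.

(** Only the two edges at the apex have weight 1 / sqrt (n - 1), the other
products of neighbouring labels being at most 4 < n - 1; two adjacent marked
edges on a cycle of length at least three are fixed by no rotation. *)
Lemma fan_weight_irreducible : irreducible fan_weight.
Proof.
have inj k l : (k <= n)%N -> (l <= n)%N ->
    periodic_ext fan_weight k = periodic_ext fan_weight l -> fan_edge k = fan_edge l.
  move=> kn ln; rewrite !fan_weightE// => /invr_inj/eqP.
  by rewrite eqr_sqrt ?ler0n// eqr_nat => /eqP.
have e0 : fan_edge 0 = n.-1.
  by rewrite /fan_edge /fan modn_small/= ?muln1//; lia.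
have en : fan_edge n = n.-1.
  rewrite /fan_edge modnn /fan /= eqxx orbT mulnC.
  by have -> : n == 0%N = false by [lia]; rewrite muln1.
have em m : (0 < m < n)%N -> (fan_edge m <= 4)%N.
  move=> /andP[m0 mn]; rewrite /fan_edge modn_small//.
  have fm k : (0 < k)%N -> (fan k <= 2)%N.
    by move=> k0; rewrite /fan [k == 0%N]gtn_eqF//; case: ifP.
  by apply: (@leq_mul _ _ 2 2); apply: fm.
apply/irreducibleE => m /andP[m0 mp] H.
have [mn|mn] := eqVneq m n.
  have := H n; rewrite mn (_ : n + n = n.-1 + p)%N; last by lia.
  rewrite periodic_extD => E.
  have E' : fan_edge n.-1 = fan_edge n by apply: inj E; lia.
  by have := em n.-1; rewrite E' en; lia.
have := H 0%N; rewrite add0n => E.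
have E' : fan_edge m = fan_edge 0 by apply: inj E; lia.
by have := em m; rewrite E' e0; lia.
Qed.

Definition gauge f (m : nat) : R := Num.sqrt (fan m)%:R * f m.

(** With c j = sqrt (fan j), the weight of the edge from j to j + 1 is
1 / (c j * c (j+1)), so each neighbour contributes f (j+1) / c j or
f (j-1) / c j, and fan j * f j / c j is c j * f j. *)
Lemma fan_weight_eq f : frieze_eq f ->
  real_floquet_eq (periodic_ext fan_weight)
    (periodic_ext (0 : 'rV[R]_p)) (- 1) 1 (gauge f).
Proof.
move=> H j jn.
have V0 m : periodic_ext (0 : 'rV[R]_p) m = 0 by rewrite /periodic_ext mxE.
rewrite V0 mul0r add0r mul1r {1}/gauge.
pose c m : R := Num.sqrt (fan m)%:R.
have c0 m : c m != 0 by rewrite gt_eqF// sqrtr_gt0 ltr0n fan_gt0.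
have cc : (fan j)%:R = c j * c j by rewrite -expr2 sqr_sqrtr ?ler0n.
have wE m : (m <= n)%N -> periodic_ext fan_weight m = (c m * c (m.+1 %% p)%N)^-1.
  by move=> mn; rewrite fan_weightE// natrM sqrtrM ?ler0n.
have cn : periodic_ext fan_weight n = (c n * c 0%N)^-1 by rewrite wE// modnn.
have cj m : (m < n)%N -> periodic_ext fan_weight m = (c m * c m.+1)^-1.
  by move=> mn; rewrite wE ?modn_small// ltnW.
have -> : gauge f j = (c j)^-1 * ((fan j)%:R * f j).
  by rewrite cc mulrA mulKf ?c0.
rewrite -H// mulrDr /gauge; congr (_ + _).
  have [j0|j0] := eqVneq j 0%N.
    rewrite cn j0 -/(c n); field; by rewrite !c0.
  rewrite cj ?prednK ?lt0n//.
  rewrite -/(c j.-1); field; by rewrite !c0.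
have [jE|jE] := eqVneq j n.
  rewrite cn jE -/(c 0%N); field; by rewrite !c0.
rewrite cj; last by lia.
rewrite -/(c j.+1); field; by rewrite !c0.
Qed.

(** Alternating signs anticommute with hopping; around a cycle of odd length they
also change the boundary sign. *)
Lemma real_floquet_eq_twist A V s x f : ~~ odd n -> (forall j, V j = 0) ->
  real_floquet_eq A V s x f ->
  real_floquet_eq A V (- s) (- x) (fun m => (-1) ^+ m * f m).
Proof.
move=> nodd V0 H j jn.
have sn : (-1) ^+ n = 1 :> R by rewrite -signr_odd (negbTE nodd).
rewrite [RHS]mulrCA [- x * _]mulNr -H// V0 !mul0r !add0r mulrN mulrDr opprD.
congr (_ + _).
  case: eqP => [->|j0]; first by rewrite sn expr0; ring.
  by rewrite -[in RHS](prednK (n := j)) ?exprS; [ring|lia].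
case: eqP => [->|_]; first by rewrite sn expr0; ring.
by rewrite exprS; ring.
Qed.

Lemma fan_weight_closed_gap : closed_gap fan_weight 0 1.
Proof.
apply: (real_closed_gap (theta := 2^-1) (s := -1) _ expi2pi_half expi2piN_half
  (fan_weight_eq fan_sol1P) (fan_weight_eq fan_sol2P)).
- by rewrite in_itv/=; lra.
- by rewrite /gauge /fan_sol1 mulr0.
- by rewrite /gauge mulr1 gt_eqF// sqrtr_gt0 ltr0n fan_gt0.
- by rewrite /gauge mulr1 gt_eqF// sqrtr_gt0 ltr0n fan_gt0.
Qed.

Lemma fan_weight_closed_gapN : ~~ odd n -> closed_gap fan_weight 0 (- 1).
Proof.
move=> nodd.
have V0 m : periodic_ext (0 : 'rV[R]_p) m = 0 by rewrite /periodic_ext mxE.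
have tw f (H : frieze_eq f) := real_floquet_eq_twist nodd V0 (fan_weight_eq H).
have e0 : expi2pi (0 : R) = (- - 1)%:C by rewrite opprK expi2pi0.
have eN0 : expi2pi (- (0 : R)) = (- - 1)%:C by rewrite oppr0 e0.
apply: (real_closed_gap (theta := 0) (s := - - 1) _ e0 eN0
  (tw _ fan_sol1P) (tw _ fan_sol2P)).
- by rewrite in_itv/= lexx ler01.
- by rewrite /gauge /fan_sol1 !mulr0.
- rewrite /gauge expr1 mulN1r oppr_eq0 mulr1.
  by rewrite gt_eqF// sqrtr_gt0 ltr0n fan_gt0.
- by rewrite /gauge expr0 mul1r mulr1 gt_eqF// sqrtr_gt0 ltr0n fan_gt0.
Qed.

End Examples.

Theorem theorem1p2 (R : realType) (p : nat) (hp : (7 <= p)%N) :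
  [/\ (1 <= gDSO R p)%N,
      (p %% 4 <> 2)%N -> (gDSO R p <= p - 3)%N,
      (~~ odd p -> (1 <= gODJM R p)%N) /\ (odd p -> (2 <= gODJM R p)%N)
    & (gODJM R p <= p - 3)%N].
Proof.
case: p hp => // n n6; have n2 : (2 <= n)%N by lia.
have gapsDSO s : [set ngapsDSO v | v in [set v : 'rV[R]_n.+1 | irreducible v]] s ->
    (s <= n - 2)%N by move=> [v irr <-]; exact: ngapsDSO_le.
have gapsODJM s : [set ngapsODJM a | a in
    [set a : 'rV[R]_n.+1 | (forall i, 0 < a 0 i)%R /\ irreducible a]] s ->
    (s <= n - 2)%N by move=> [a [a0 irr] <-]; exact: ngapsODJM_le.
have fanODJM : (ngapsODJM (fan_weight R n) <= gODJM R n.+1)%N.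
  apply: (le_max_nat gapsODJM); exists (fan_weight R n) => //.
  by split; [exact: fan_weight_gt0|exact: fan_weight_irreducible].
rewrite subSS; split.
- apply: (@leq_trans (ngapsDSO (fan_potential R n))).
    exact: ngaps_ge1 (fan_potential_closed_gap R n6).
  apply: (le_max_nat gapsDSO); exists (fan_potential R n) => //.
  exact: fan_potential_irreducible.
- by move=> _; exact: max_nat_le.
- split=> [_|podd]; apply: leq_trans fanODJM.
    exact: ngaps_ge1 (fan_weight_closed_gap R n6).
  apply: (ngaps_ge2 (fan_weight_closed_gap R n6)
                    (fan_weight_closed_gapN R n6 podd)).
  by rewrite -subr_eq0 opprK -mulr2n pnatr_eq0.
- exact: max_nat_le.
Qed.
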